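(* Let $c<1$, let $w=\sqrt{1-c}$, and let $G_c$ be the connected and simply connected Lie group whose Lie algebra $\mathfrak{g}_c$ has a basis $\{x,y,z\}$ with $[x,y]=0$, $[z,x]=y$, $[z,y]=-cx+2y$. Let $$P=\begin{bmatrix}\frac1{2w}&\frac{1+w}{2w}&0\\-\frac1{2w}&\frac{w-1}{2w}&0\\0&0&1\end{bmatrix}.$$ Then any left invariant Lorentzian metric on $G_c$ is equivalent up to automorphism to a metric whose associated matrix (with respect to $\{x,y,z\}$) is of the form $P^tMP$, where $M$ is of the form $$ \begin{bmatrix}0&0&1\\0&1&0\\1&0&0\end{bmatrix},\ \begin{bmatrix}1&0&0\\0&0&1\\0&1&0\end{bmatrix},\ \begin{bmatrix}1&1&0\\1&1&\mu\\0&\mu&0\end{bmatrix},\ \begin{bmatrix}1&0&0\\0&1&0\\0&0&-\mu\end{bmatrix},\ \begin{bmatrix}1&0&0\\0&-1&0\\0&0&\mu\end{bmatrix},\ \begin{bmatrix}-1&0&0\\0&1&0\\0&0&\mu\end{bmatrix}, $$ $$ \begin{bmatrix}0&1&0\\1&0&0\\0&0&\mu\end{bmatrix},\ \begin{bmatrix}0&1&0\\1&1&0\\0&0&\mu\end{bmatrix},\ \begin{bmatrix}0&1&0\\1&-1&0\\0&0&\mu\end{bmatrix},\ \begin{bmatrix}1&1&0\\1&\tau&0\\0&0&\nu\end{bmatrix},\ \text{or}\ \begin{bmatrix}-1&1&0\\1&-\eta&0\\0&0&\mu\end{bmatrix}, $$ where $\mu>0$, $\nu(\tau-1)<0$ and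 $\eta<1$.
   Context: A left invariant Lorentzian metric $h$ on a connected three-dimensional Lie group $G$ is identified with a nondegenerate symmetric bilinear form of signature $(+,+,-)$ on its Lie algebra $\mathfrak{g}$. With respect to a fixed basis of $\mathfrak{g}$, its associated matrix $[h]$ is the symmetric matrix with $h(u,v)=[u]^t[h][v]$, where $[u]$ is the coordinate column vector of $u$. Two left invariant Lorentzian metrics $h,h'$ on $G$ are equivalent up to automorphism if there is a Lie algebra automorphism $\varphi\in\mathrm{Aut}(\mathfrak{g})$ with $[h']=[\varphi]^t[h][\varphi]$. All matrices $M$ listed are understood with parameters for which the form is of signature $(+,+,-)$ (which the stated parameter conditions guarantee). $P$ is the transition matrix from coordinates in $\{x,y,z\}$ to coordinates in the basis $x_1=-(1-w)x+y$, $x_2=-(1+w)x+y$, $x_3=z$ of $\mathfrak{g}_c$; thus the metric with matrix $P^tMP$ in $\{x,y,z\}$ is the one with matrix $M$ in $\{x_1,x_2,x_3\}$. *)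

(* Defs.v *)
From HB Require Import structures.
From mathcomp Require Import all_boot all_order all_algebra.
From mathcomp Require Import sesquilinear reals.

Set Implicit Arguments.
Unset Strict Implicit.
Unset Printing Implicit Defensive.

Import Order.TTheory GRing.Theory Num.Theory.
Local Open Scope ring_scope.

HB.mixin Record Vector_isLieAlgebra (F : fieldType) g of Vector F g := {
  lie_bracket : {bilinear g -> g -> g};
  lie_bracket_alt : forall u, lie_bracket u u = 0;
  lie_bracket_jacobi : forall u v w,
    lie_bracket u (lie_bracket v w) + lie_bracket v (lie_bracket w u)
      + lie_bracket w (lie_bracket u v) = 0
}.

#[short(type="lieAlgType")]
HB.structure Definition LieAlgebra (F : fieldType) :=
  { g of Vector_isLieAlgebra F g & Vector F g }.

Definition lie_automorphism (F : fieldType) (g : lieAlgType F)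
    (phi : 'End(g)) : Prop :=
  bijective phi /\ forall u v, phi (lie_bracket u v) = lie_bracket (phi u) (phi v).

Section Coordinates.
Variables (F : fieldType) (g : vectType F) (n : nat) (e : n.-tuple g).

Definition coord_col (u : g) : 'cV[F]_n := \col_i coord e i u.

Definition endo_mx (phi : 'End(g)) : 'M[F]_n :=
  \matrix_(i, j) coord e i (phi e`_j).

Definition form_mx (h : {symmetric g}) : 'M[F]_n :=
  \matrix_(i, j) h e`_i e`_j.

Lemma coord_col_endo (e_basis : basis_of fullv e) (phi : 'End(g)) u :
  coord_col (phi u) = endo_mx phi *m coord_col u.
Proof.
apply/colP => i; rewrite !mxE {1}(coord_basis e_basis (memvf u)).
rewrite !linear_sum; apply: eq_bigr => j _.
by rewrite !mxE !linearZ /= mulrC.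
Qed.

Lemma form_mxE (e_basis : basis_of fullv e) (h : {symmetric g}) u v :
  h u v = ((coord_col u)^T *m form_mx h *m coord_col v) 0 0.
Proof.
rewrite {1}(coord_basis e_basis (memvf u)) {1}(coord_basis e_basis (memvf v)).
rewrite linear_sumr mxE; apply: eq_bigr => j _.
rewrite linearZr_LR linear_sumlz !mxE /= mulrC; congr (_ * _).
by apply: eq_bigr => i _; rewrite linearZl_LR !mxE.
Qed.

End Coordinates.

Section Lorentzian.
Variable R : realType.

(* Signature (+,+,-), in the sense of Sylvester's law of inertia. *)
Definition lorentzian (g : vectType R) (h : {symmetric g}) : Prop :=
  nondegenerate h /\
  exists2 b : 3.-tuple g, basis_of fullv b &
    form_mx b h = diag_mx (\row_j [:: 1; 1; -1]`_j).

Definition equivalent_upto_aut (g : lieAlgType R) n (e : n.-tuple g)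
    (h h' : {symmetric g}) : Prop :=
  exists2 phi : 'End(g), lie_automorphism phi &
    form_mx e h' = (endo_mx e phi)^T *m form_mx e h *m endo_mx e phi.

Definition mx3 (rows : seq (seq R)) : 'M[R]_3 :=
  \matrix_(i, j) (nth [::] rows i)`_j.

Definition transition_mx (w : R) : 'M[R]_3 :=
  mx3 [:: [::   1 / (2 * w);  (1 + w) / (2 * w); 0];
          [:: - 1 / (2 * w);  (w - 1) / (2 * w); 0];
          [::             0;                  0; 1]].

Variant normal_form : 'M[R]_3 -> Prop :=
| NF1 : normal_form (mx3 [:: [:: 0; 0; 1]; [:: 0; 1; 0]; [:: 1; 0; 0]])
| NF2 : normal_form (mx3 [:: [:: 1; 0; 0]; [:: 0; 0; 1]; [:: 0; 1; 0]])
| NF3 mu of 0 < mu :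
    normal_form (mx3 [:: [:: 1; 1; 0]; [:: 1; 1; mu]; [:: 0; mu; 0]])
| NF4 mu of 0 < mu :
    normal_form (mx3 [:: [:: 1; 0; 0]; [:: 0; 1; 0]; [:: 0; 0; - mu]])
| NF5 mu of 0 < mu :
    normal_form (mx3 [:: [:: 1; 0; 0]; [:: 0; -1; 0]; [:: 0; 0; mu]])
| NF6 mu of 0 < mu :
    normal_form (mx3 [:: [:: -1; 0; 0]; [:: 0; 1; 0]; [:: 0; 0; mu]])
| NF7 mu of 0 < mu :
    normal_form (mx3 [:: [:: 0; 1; 0]; [:: 1; 0; 0]; [:: 0; 0; mu]])
| NF8 mu of 0 < mu :
    normal_form (mx3 [:: [:: 0; 1; 0]; [:: 1; 1; 0]; [:: 0; 0; mu]])
| NF9 mu of 0 < mu :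
    normal_form (mx3 [:: [:: 0; 1; 0]; [:: 1; -1; 0]; [:: 0; 0; mu]])
| NF10 tau nu of nu * (tau - 1) < 0 :
    normal_form (mx3 [:: [:: 1; 1; 0]; [:: 1; tau; 0]; [:: 0; 0; nu]])
| NF11 mu eta of 0 < mu & eta < 1 :
    normal_form (mx3 [:: [:: -1; 1; 0]; [:: 1; - eta; 0]; [:: 0; 0; mu]]).

End Lorentzian.

(* Main.v *)
(* In the eigenbasis x1, x2 of ad z on the abelian ideal spanned by x and y,
   with eigenvalues 1 + w and 1 - w, the maps x1 -> a x1, x2 -> b x2,
   z -> p x1 + q x2 + z with a, b <> 0 are automorphisms.  When the form is
   nondegenerate on that ideal, z can be sheared into its orthogonal
   complement; otherwise z can be made isotropic and orthogonal to x1 or x2.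
   Rescaling x1 and x2 then normalises the entries, and the signature leaves
   exactly the listed signs: the Gram determinant is negative, and the form
   takes a positive value on every plane. *)
Require Import Defs.
From HB Require Import structures.
From mathcomp Require Import all_boot all_order all_algebra.
From mathcomp Require Import sesquilinear reals ring lra.

Import Order.TTheory GRing.Theory Num.Theory.
Local Open Scope ring_scope.

(** * Normalising Gram matrices by rescaling and shearing *)

Ltac entrywise_field :=
  congr [:: [:: _; _; _]; [:: _; _; _]; [:: _; _; _]]; field;
  by repeat (apply/andP; split).

(** The square fixes [k] only up to sign; tying its sign to that of [t] is what later makes the
    parameter of [NF3] positive. All other uses take [t = 1]. *)
Lemma inv_sqr_exists {R : realType} (r t : R) : 0 < r -> t != 0 ->
  exists k, 0 < k * t /\ r = (k ^+ 2)^-1.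
Proof.
move=> r0 t0; exists (Num.sg t * (Num.sqrt r)^-1); split.
  by rewrite mulrAC -normrEsg mulr_gt0 ?normr_gt0 ?invr_gt0 ?sqrtr_gt0.
by rewrite exprMn sqr_sg t0 mul1r exprVn invrK sqr_sqrtr ?ltW.
Qed.

Lemma eq_normal_form {R : realType} (r r' : seq (seq R)) :
  normal_form (mx3 r') -> r' = r -> normal_form (mx3 r).
Proof. by move=> + <-. Qed.

(** The case where the third vector is orthogonal to the plane. The hypotheses say that the Gram
    determinant is negative and that the plane is not negative definite; each sign pattern of [A],
    [B], [C] they allow leads to one of [NF4] to [NF11]. *)
Lemma block_normal_form {R : realType} (A B C s : R) :
    (A * C - B ^+ 2) * s < 0 -> (0 <= A * C - B ^+ 2 -> 0 < A) ->
  exists a b, [/\ a != 0, b != 0 & normal_form (mx3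
    [:: [:: a ^+ 2 * A; a * b * B; 0];
        [:: a * b * B; b ^+ 2 * C; 0]; [:: 0; 0; s]])].
Proof.
move=> det_lt0 A_gt0.
have inv_sqr (r : R) : 0 < r -> exists2 k, k != 0 & r = (k ^+ 2)^-1.
  move=> r0; have [k [k0 ->]] := inv_sqr_exists _ _ r0 (oner_neq0 R).
  by exists k => //; rewrite mulr1 in k0; rewrite gt_eqF.
have [B0|B0] := eqVneq B 0.
  rewrite {}B0 expr0n subr0 in det_lt0 A_gt0 *.
  have [A0|A0|A0] := ltgtP A 0.
  - have AC_lt0 : A * C < 0 by case: ltP => // /A_gt0; lra.
    have C0 : 0 < C by rewrite -(nmulr_rlt0 _ A0).
    have s0 : 0 < s by rewrite -(nmulr_rlt0 _ AC_lt0).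
    have [a a0 eA] : exists2 a, a != 0 & - A = (a ^+ 2)^-1 by apply: inv_sqr; lra.
    have [b b0 eC] := inv_sqr _ C0.
    exists a, b; split=> //; apply: (eq_normal_form _ _ (NF6 s0)).
    by rewrite -[A]opprK eA eC; entrywise_field.
  - have [a a0 ->] := inv_sqr _ A0.
    have [C0|C0|C0] := ltgtP C 0.
    + have AC_lt0 : A * C < 0 by rewrite pmulr_rlt0.
      have s0 : 0 < s by rewrite -(nmulr_rlt0 _ AC_lt0).
      have [b b0 eC] : exists2 b, b != 0 & - C = (b ^+ 2)^-1 by apply: inv_sqr; lra.
      exists a, b; split=> //; apply: (eq_normal_form _ _ (NF5 s0)).
      by rewrite -[C]opprK eC; entrywise_field.
    + have s0 : 0 < - s by rewrite oppr_gt0 -(pmulr_rlt0 _ (mulr_gt0 A0 C0)).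
      have [b b0 eC] := inv_sqr _ C0.
      exists a, b; split=> //; apply: (eq_normal_form _ _ (NF4 s0)).
      by rewrite eC opprK; entrywise_field.
    + by rewrite C0 mulr0 mul0r ltxx in det_lt0.
  - by rewrite A0 !mul0r ltxx in det_lt0.
have [A0|A0|A0] := ltgtP A 0.
- have [a a0 eA] : exists2 a, a != 0 & - A = (a ^+ 2)^-1 by apply: inv_sqr; lra.
  (* Once [a] has turned [A] into -1, this [b] turns the off-diagonal entry into 1. *)
  pose b := (a * B)^-1.
  have b0 : b != 0 by rewrite invr_neq0 // mulf_neq0.
  have eB : B = (a * b)^-1 by rewrite /b; field; rewrite a0 B0.
  have d_lt0 : A * C - B ^+ 2 < 0.
    by case: ltP => // /A_gt0; lra.
  have s0 : 0 < s by rewrite -(nmulr_rlt0 _ d_lt0).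
  (* With [eta := - (b ^+ 2 * C)], the rescaled block has determinant [eta - 1], which keeps the
     negative sign of [A * C - B ^+ 2]. *)
  have eta_lt1 : - (b ^+ 2 * C) < 1.
    have b2 : 0 < b ^+ 2 by rewrite exprn_even_gt0.
    have a2 : 0 < a ^+ 2 by rewrite exprn_even_gt0.
    have : a ^+ 2 * b ^+ 2 * (A * C - B ^+ 2) < 0.
      by rewrite pmulr_rlt0 // mulr_gt0.
    suff -> : a ^+ 2 * b ^+ 2 * (A * C - B ^+ 2) = - (b ^+ 2 * C) - 1 by lra.
    by rewrite -[A]opprK eA eB; field; rewrite a0 b0.
  exists a, b; split=> //; apply: (eq_normal_form _ _ (NF11 s0 eta_lt1)).
  rewrite -[A]opprK eA eB; entrywise_field.
- have [a a0 eA] := inv_sqr _ A0.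
  pose b := (a * B)^-1.
  have b0 : b != 0 by rewrite invr_neq0 // mulf_neq0.
  have eB : B = (a * b)^-1 by rewrite /b; field; rewrite a0 B0.
  (* With [tau := b ^+ 2 * C] and [nu := s], this is the determinant of the whole rescaled
     matrix. *)
  have nu_tau : s * (b ^+ 2 * C - 1) < 0.
    have b2 : 0 < b ^+ 2 by rewrite exprn_even_gt0.
    have a2 : 0 < a ^+ 2 by rewrite exprn_even_gt0.
    have : a ^+ 2 * b ^+ 2 * ((A * C - B ^+ 2) * s) < 0.
      by rewrite pmulr_rlt0 // mulr_gt0.
    suff -> : a ^+ 2 * b ^+ 2 * ((A * C - B ^+ 2) * s) = s * (b ^+ 2 * C - 1) by [].
    by rewrite eA eB; field; rewrite a0 b0.
  exists a, b; split=> //; apply: (eq_normal_form _ _ (NF10 nu_tau)).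
  rewrite eA eB; entrywise_field.
- have s0 : 0 < s by rewrite A0 in det_lt0; nra.
  rewrite A0.
  (* Since [A = 0], [b] is spent on bringing [C] to -1 or 1 (it is free if [C = 0]), and [a] then
     makes the off-diagonal entry 1. *)
  have [C0|C0|C0] := ltgtP C 0.
  + have [b b0 eC] : exists2 b, b != 0 & - C = (b ^+ 2)^-1 by apply: inv_sqr; lra.
    exists (b * B)^-1, b; split=> //; first by rewrite invr_neq0 // mulf_neq0.
    apply: (eq_normal_form _ _ (NF9 s0)).
    rewrite -[C]opprK eC; entrywise_field.
  + have [b b0 eC] := inv_sqr _ C0.
    exists (b * B)^-1, b; split=> //; first by rewrite invr_neq0 // mulf_neq0.
    apply: (eq_normal_form _ _ (NF8 s0)).
    rewrite eC; entrywise_field.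
  + exists B^-1, 1; split; rewrite ?invr_neq0 ?oner_neq0 //.
    apply: (eq_normal_form _ _ (NF7 s0)).
    rewrite C0; entrywise_field.
Qed.

(** The matrix is the Gram matrix of [a x1], [b x2], [p x1 + q x2 + z], where [A], [B], [C], [u],
    [v], [s] are the products of [x1], [x2], [z]. The first hypothesis is negativity of the Gram
    determinant; the second says that the plane contains a vector of positive square. *)
Lemma gram_normal_form {R : realType} (A B C u v s : R) :
    (A * C - B ^+ 2) * s < A * v ^+ 2 - 2 * B * u * v + C * u ^+ 2 ->
    (0 <= A * C - B ^+ 2 -> 0 < A \/ 0 < C) ->
  exists a b p q, [/\ a != 0, b != 0 & normal_form (mx3
    [:: [:: a ^+ 2 * A; a * b * B; a * (A * p + B * q + u)];
        [:: a * b * B; b ^+ 2 * C; b * (B * p + C * q + v)];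
        [:: a * (A * p + B * q + u); b * (B * p + C * q + v);
            A * p ^+ 2 + 2 * B * p * q + C * q ^+ 2 + 2 * u * p + 2 * v * q + s]])].
Proof.
move=> det_lt0 AC_gt0.
have [d0|d0] := eqVneq (A * C - B ^+ 2) 0; last first.
  (* Cramer's rule for [A p + B q + u = 0] and [B p + C q + v = 0]: the sheared [z] is orthogonal to
     the plane. *)
  pose p := (B * v - C * u) / (A * C - B ^+ 2).
  pose q := (B * u - A * v) / (A * C - B ^+ 2).
  pose s' := A * p ^+ 2 + 2 * B * p * q + C * q ^+ 2 + 2 * u * p + 2 * v * q + s.
  (* The shear has determinant 1, so the Gram determinant is unchanged. *)
  have ds' : (A * C - B ^+ 2) * s' < 0.
    suff -> : (A * C - B ^+ 2) * s' = (A * C - B ^+ 2) * s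
        - (A * v ^+ 2 - 2 * B * u * v + C * u ^+ 2) by lra.
    by rewrite /s' /p /q; field.
  have A_gt0 : 0 <= A * C - B ^+ 2 -> 0 < A.
    move=> /[dup] d_ge0 /AC_gt0 [//|C0].
    have d_gt0 : 0 < A * C - B ^+ 2 by rewrite lt_neqAle eq_sym d0.
    rewrite -(pmulr_lgt0 _ C0); have := sqr_ge0 B; lra.
  have [a [b [a0 b0 nf]]] := block_normal_form _ _ _ _ ds' A_gt0.
  exists a, b, p, q; split=> //; apply: (eq_normal_form _ _ nf).
  have -> : A * p + B * q + u = 0 by rewrite /p /q; field.
  have -> : B * p + C * q + v = 0 by rewrite /p /q; field.
  by rewrite !mulr0.
have {}AC_gt0 : 0 < A \/ 0 < C by apply: AC_gt0; rewrite d0.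
rewrite d0 mul0r in det_lt0.
have BAC : B ^+ 2 = A * C by lra.
have [A0|A0] := eqVneq A 0.
  have B0 : B = 0 by apply/eqP; rewrite -sqrf_eq0 BAC A0 mul0r.
  have C0 : 0 < C by case: AC_gt0 => //; rewrite A0 ltxx.
  have u0 : u != 0.
    by apply: contraTneq det_lt0 => ->; rewrite A0 B0 -leNgt; lra.
  have [b [+ eC]] := inv_sqr_exists _ _ C0 (oner_neq0 R).
  rewrite mulr1 => /gt_eqF/negbT b0.
  (* Here [q] makes the new [z] orthogonal to [x2], [p] then makes it isotropic, and [a] scales its
     product with [x1] to 1. The case [C = 0] below exchanges [x1] and [x2]. *)
  exists u^-1, b, ((v ^+ 2 / C - s) / (2 * u)), (- v / C).
  rewrite invr_neq0 //; split=> //; apply: (eq_normal_form _ _ (NF1 _)).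
  rewrite A0 B0 eC; entrywise_field.
have [C0|C0] := eqVneq C 0.
  have B0 : B = 0 by apply/eqP; rewrite -sqrf_eq0 BAC C0 mulr0.
  have {}A0 : 0 < A by case: AC_gt0 => //; rewrite C0 ltxx.
  have v0 : v != 0.
    by apply: contraTneq det_lt0 => ->; rewrite C0 B0 -leNgt; lra.
  have [a [+ eA]] := inv_sqr_exists _ _ A0 (oner_neq0 R).
  rewrite mulr1 => /gt_eqF/negbT a0.
  exists a, v^-1, (- u / A), ((u ^+ 2 / A - s) / (2 * v)).
  rewrite invr_neq0 //; split=> //; apply: (eq_normal_form _ _ (NF2 _)).
  rewrite C0 B0 eA; entrywise_field.
have B0 : B != 0 by rewrite -sqrf_eq0 BAC mulf_neq0.
have A_gt0 : 0 < A.
  by case: AC_gt0 => // C_gt0; rewrite -(pmulr_lgt0 _ C_gt0) -BAC exprn_even_gt0.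
have eC : C = B ^+ 2 / A by rewrite BAC; field.
(* The vector [x2 - (B / A) x1] spans the kernel of the form on the plane, and [m] is its product
   with [z]. The Gram determinant is [- A * m ^+ 2], so [m] is nonzero. *)
pose m := v - B * u / A.
have m0 : m != 0.
  apply: contraTneq det_lt0 => m0.
  suff -> : A * v ^+ 2 - 2 * B * u * v + C * u ^+ 2 = A * m ^+ 2.
    by rewrite m0 expr0n mulr0 ltxx.
  by rewrite eC /m; field.
have mB0 : m / B != 0 by rewrite mulf_neq0 // invr_neq0.
(* The sign of [a] is chosen to make [b * m = m / (a * B)], the parameter [mu] of [NF3],
   positive. *)
have [a [a_sgn eA]] := inv_sqr_exists _ _ A_gt0 mB0.
have a0 : a != 0 by apply: contraTneq a_sgn => ->; rewrite mul0r ltxx.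
pose b := (a * B)^-1.
have b0 : b != 0 by rewrite invr_neq0 // mulf_neq0.
have mu0 : 0 < b * m.
  rewrite (_ : b * m = a * (m / B) * (a ^+ 2)^-1); last first.
    by rewrite /b; field; rewrite a0 B0.
  by rewrite mulr_gt0 // -eA.
(* Orthogonality to [x1] forces [p = - (u + B q) / A]; the square of the new [z] is then
   [2 m q + s - u ^+ 2 / A], and [q] makes it vanish. *)
pose q := - (s - u ^+ 2 / A) / (2 * m).
exists a, b, (- (u + B * q) / A), q; split=> //; apply: (eq_normal_form _ _ (NF3 mu0)).
have eq_m : (s - u ^+ 2 / A) = - 2 * m * q by rewrite /q; clearbody m; field; rewrite ?m0 ?A0.
have es : s = u ^+ 2 / A - 2 * m * q by lra.
clearbody q; rewrite es eC /b /m eA; entrywise_field.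
Qed.

(** * Pullbacks of symmetric forms and change of basis *)

Section Pullback.
Context {F : fieldType} {g : vectType F} (h : {symmetric g}) (phi : 'End(g)).

Definition pullback (u v : g) : F := h (phi u) (phi v).

Fact pullback_morphl v : zmod_morphism (pullback^~ v).
Proof. by move=> u u'; rewrite /pullback linearB linearBl. Qed.
Fact pullback_morphr u : zmod_morphism (pullback u).
Proof. by move=> v v'; rewrite /pullback linearB linearBr. Qed.
Fact pullback_scalel v : scalable_for *%R (pullback^~ v).
Proof. by move=> k u; rewrite /pullback linearZ linearZl_LR. Qed.
Fact pullback_scaler u : scalable_for (idfun \; *%R) (pullback u).
Proof. by move=> k v; rewrite /pullback linearZ linearZr_LR. Qed.
Fact pullback_sym u v : pullback u v = (-1) ^+ false * idfun (pullback v u).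
Proof. exact: hermitian_subproof. Qed.

HB.instance Definition _ := isBilinear.Build F g g F *%R (idfun \; *%R) pullback
  pullback_morphl pullback_morphr pullback_scalel pullback_scaler.
HB.instance Definition _ :=
  isHermitianSesquilinear.Build F g false idfun pullback pullback_sym.

End Pullback.

(** As [f] may be any family, this serves both for the image of a basis under an endomorphism and
    for a change of basis. *)
Lemma form_mx_family {F : fieldType} {g : vectType F} {n : nat} (e f : n.-tuple g)
    (h : {symmetric g}) : basis_of fullv e ->
  form_mx f h = (\matrix_(i, j) coord e i f`_j)^T *m form_mx e h
                  *m (\matrix_(i, j) coord e i f`_j).
Proof.
move=> e_basis; apply/matrixP => i j.
rewrite mxE (form_mxE e_basis) !mxE; apply: eq_bigr => k _; rewrite !mxE.
by congr (_ * _); apply: eq_bigr => l _; rewrite !mxE.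
Qed.

Lemma form_mx_pullback {F : fieldType} {g : vectType F} {n : nat} (e : n.-tuple g)
    (h : {symmetric g}) (phi : 'End(g)) : basis_of fullv e ->
  form_mx e (pullback h phi : {symmetric g}) =
    (endo_mx e phi)^T *m form_mx e h *m endo_mx e phi.
Proof.
move=> e_basis.
have nth_phi (i : 'I_n) : (map_tuple phi e)`_i = phi e`_i.
  by rewrite (nth_map 0) ?size_tuple.
have -> : endo_mx e phi = \matrix_(i, j) coord e i (map_tuple phi e)`_j.
  by apply/matrixP => i j; rewrite !mxE nth_phi.
rewrite -(form_mx_family _ _ _ e_basis).
by apply/matrixP => i j; rewrite !mxE !nth_phi.
Qed.

Lemma lorentzian_pullback {R : realType} {g : vectType R} (h : {symmetric g})
    (phi : 'End(g)) :
  bijective phi -> lorentzian h -> lorentzian (pullback h phi : {symmetric g}).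
Proof.
move=> [psi phiK psiK] [/eqP h_nondeg [b b_basis b_gram]]; split.
  apply/eqP/vspaceP => u; rewrite memv0.
  apply/mem_orthovP/eqP => [u_orth|-> v _]; last by rewrite linear0l.
  apply: (can_inj phiK); rewrite linear0; apply/eqP; rewrite -memv0 -h_nondeg.
  by apply/mem_orthovP => v _; rewrite -(psiK v); apply: u_orth; rewrite memvf.
have lker0_phi : lker phi == 0%VS by apply/lker0P; apply: can_inj phiK.
(* The preimage of a diagonalising basis has the same Gram matrix for the pullback. *)
exists (map_tuple (phi^-1)%VF b).
  rewrite basisEdim -limg_span (span_basis b_basis) size_map size_tuple.
  rewrite (size_basis b_basis) leqnn andbT.
  by apply/subvP => u _; rewrite -(lker0_lfunK lker0_phi u) memv_img ?memvf.
rewrite -b_gram; apply/matrixP => i j; rewrite !mxE /= /pullback.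
by rewrite !(nth_map 0) ?size_tuple // !(lker0_lfunVK lker0_phi).
Qed.

(** * Automorphisms when [ad z] is diagonal on an abelian plane *)

Lemma lie_bracket_antisym {F : fieldType} {g : lieAlgType F} (u v : g) :
  lie_bracket u v = - lie_bracket v u.
Proof.
apply/eqP; rewrite -addr_eq0; apply/eqP.
have := lie_bracket_alt (u + v).
by rewrite linearDl !linearDr !lie_bracket_alt addr0 add0r.
Qed.

Section DiagonalizableBracket.
Context {F : fieldType} {g : lieAlgType F} {x1 x2 z : g} {l1 l2 : F}.
Hypothesis f_basis : basis_of fullv [:: x1; x2; z].
Hypothesis bracket_x1x2 : lie_bracket x1 x2 = 0.
Hypothesis bracket_zx1 : lie_bracket z x1 = l1 *: x1.
Hypothesis bracket_zx2 : lie_bracket z x2 = l2 *: x2.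

Lemma basis3_decomp (u : g) : exists u1 u2 u3, u = u1 *: x1 + u2 *: x2 + u3 *: z.
Proof.
have f_tuple : basis_of fullv [tuple x1; x2; z] by [].
rewrite (coord_basis f_tuple (memvf u)) !big_ord_recl big_ord0 addr0 /= addrA.
by do 3 eexists.
Qed.

Lemma lie_bracketE (u1 u2 u3 v1 v2 v3 : F) :
  lie_bracket (u1 *: x1 + u2 *: x2 + u3 *: z) (v1 *: x1 + v2 *: x2 + v3 *: z) =
    (l1 * (u3 * v1 - v3 * u1)) *: x1 + (l2 * (u3 * v2 - v3 * u2)) *: x2.
Proof.
rewrite !linearDl !linearDr !linearZl_LR !linearZr_LR /= !lie_bracket_alt.
rewrite (lie_bracket_antisym x2 x1) (lie_bracket_antisym x1 z) (lie_bracket_antisym x2 z).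
rewrite bracket_x1x2 bracket_zx1 bracket_zx2 oppr0 !scaler0 !addr0 !add0r.
rewrite !scalerN !scalerA -!scaleNr addrACA -!scalerDl.
by congr (_ *: _ + _ *: _); ring.
Qed.

(** Brackets lie in the plane, where the map is diagonal like [ad z]; the shear terms [p], [q]
    cancel in [u3 * v1 - v3 * u1] and its analogue. With [a] and [b] unrestricted, the lemma also
    supplies the inverse map. *)
Lemma scale_shear (a b p q : F) : exists phi : 'End(g),
  (forall u1 u2 u3, phi (u1 *: x1 + u2 *: x2 + u3 *: z) =
     (a * u1 + p * u3) *: x1 + (b * u2 + q * u3) *: x2 + u3 *: z) /\
  (forall u v, phi (lie_bracket u v) = lie_bracket (phi u) (phi v)).
Proof.
have [phi /(_ (basis_free f_basis) erefl)] :=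
  linear_of_free [:: x1; x2; z] [:: a *: x1; b *: x2; p *: x1 + q *: x2 + z].
move=> [phi1 phi2 phiz]; have phiE u1 u2 u3 :
    linfun phi (u1 *: x1 + u2 *: x2 + u3 *: z) =
    (a * u1 + p * u3) *: x1 + (b * u2 + q * u3) *: x2 + u3 *: z.
  rewrite lfunE /= !linearD !linearZ /= phi1 phi2 phiz !scalerDr !scalerA.
  rewrite !scalerDl addrA (mulrC a) (mulrC b) (mulrC p) (mulrC q); congr (_ + _).
  by rewrite !addrA; congr (_ + _); rewrite addrAC.
exists (linfun phi); split=> // u v.
have [u1 [u2 [u3 ->]]] := basis3_decomp u; have [v1 [v2 [v3 ->]]] := basis3_decomp v.
(* A term [0 *: z] is added to the bracket so that [phiE] applies. *)
rewrite !phiE !lie_bracketE -[X in linfun phi X]addr0 -[X in _ + X](scale0r z) phiE.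
by rewrite scale0r addr0 !mulr0 !addr0; congr (_ *: _ + _ *: _); ring.
Qed.

Lemma scale_shear_automorphism (a b p q : F) : a != 0 -> b != 0 ->
  exists2 phi : 'End(g), lie_automorphism phi &
    [/\ phi x1 = a *: x1, phi x2 = b *: x2 & phi z = p *: x1 + q *: x2 + z].
Proof.
move=> a0 b0.
have [phi [phiE phi_lie]] := scale_shear a b p q.
have [psi [psiE _]] := scale_shear a^-1 b^-1 (- p / a) (- q / b).
exists phi; first split=> //.
  exists psi => u; have [u1 [u2 [u3 ->]]] := basis3_decomp u;
  by rewrite !(phiE, psiE); congr (_ *: _ + _ *: _ + _); field.
split.
- by have := phiE 1 0 0; rewrite !(scale1r, scale0r, mulr1, mulr0, addr0, add0r).
- by have := phiE 0 1 0; rewrite !(scale1r, scale0r, mulr1, mulr0, addr0, add0r).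
- by have := phiE 0 0 1; rewrite !(scale1r, scale0r, mulr1, mulr0, addr0, add0r).
Qed.

End DiagonalizableBracket.

(** * Consequences of the signature for determinants and planes *)

Lemma det_mx33 {R : comPzRingType} (A : 'M[R]_3) : \det A =
  A 0 0 * (A 1 1 * A 2 2 - A 1 2 * A 2 1) - A 0 1 * (A 1 0 * A 2 2 - A 1 2 * A 2 0)
    + A 0 2 * (A 1 0 * A 2 1 - A 1 1 * A 2 0).
Proof.
(* Indexing by natural numbers lets the lifted indices of the cofactors compute. *)
pose B i j := A (inord i) (inord j).
have AE i j : A i j = B (val i) (val j) by rewrite /B !inord_val.
rewrite (expand_det_row _ 0) !big_ord_recl big_ord0 addr0 /cofactor.
rewrite !(expand_det_row _ 0) !big_ord_recl !big_ord0 /cofactor !det_mx11 !mxE !AE /= /bump /=.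
by ring.
Qed.

(** The determinant is [- (\det Q) ^+ 2] for an invertible transition matrix [Q] to the
    diagonalising basis. *)
Lemma lorentzian_det_lt0 {R : realType} {g : vectType R} (h : {symmetric g})
    (f : 3.-tuple g) : lorentzian h -> basis_of fullv f -> \det (form_mx f h) < 0.
Proof.
move=> [_ [b b_basis b_gram]] f_basis.
pose Q : 'M_3 := \matrix_(i, j) coord b i f`_j.
have eQ : form_mx f h = Q^T *m form_mx b h *m Q by exact: form_mx_family.
have Q0 : \det Q != 0.
  pose Q' : 'M_3 := \matrix_(i, j) coord f i b`_j.
  suff : Q' *m Q = 1%:M.
    move=> /(congr1 determinant)/eqP; rewrite det_mulmx det1.
    by apply: contraTneq => ->; rewrite mulr0 eq_sym oner_neq0.
  apply/matrixP => i j; rewrite !mxE.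
  rewrite eq_sym -[RHS](coord_free j i (basis_free f_basis)).
  rewrite {1}(coord_basis b_basis (memvf f`_j)) linear_sum.
  by apply: eq_bigr => k _; rewrite linearZ !mxE mulrC.
rewrite eQ !det_mulmx det_tr b_gram det_diag !big_ord_recl big_ord0 !mxE /=.
have -> : \det Q * (1 * (1 * (-1 * 1))) * \det Q = - (\det Q ^+ 2) by ring.
by rewrite oppr_lt0 exprn_even_gt0.
Qed.

(** A plane meets the hyperplane of vanishing third coordinate, on which the form is positive
    definite, in a nonzero vector. *)
Lemma lorentzian_plane {R : realType} {g : vectType R} (h : {symmetric g}) (u v : g) :
  lorentzian h -> free [:: u; v] -> exists s t, 0 < h (s *: u + t *: v) (s *: u + t *: v).
Proof.
move=> [_ [b b_basis b_gram]] uv_free.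
pose c (k : nat) w := coord b (inord k) w.
have cE i w : coord b i w = c i w by rewrite /c inord_val.
have hE w : h w w = c 0 w ^+ 2 + c 1 w ^+ 2 - c 2 w ^+ 2.
  rewrite (form_mxE b_basis) b_gram mul_mx_diag mxE !big_ord_recl big_ord0.
  by rewrite !mxE !cE /=; ring.
have pos w : w != 0 -> c 2 w = 0 -> 0 < h w w.
  move=> + c2; apply: contraNT; rewrite hE c2 expr0n subr0 -leNgt => le0.
  have /eqP : c 0 w ^+ 2 + c 1 w ^+ 2 = 0.
    by apply/le_anti; rewrite le0 addr_ge0 ?sqr_ge0.
  rewrite paddr_eq0 ?sqr_ge0 // !sqrf_eq0 => /andP[/eqP c0 /eqP c1].
  rewrite (coord_basis b_basis (memvf w)) !big_ord_recl big_ord0 !cE /= c0 c1 c2.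
  by rewrite !scale0r !addr0.
have := uv_free; rewrite free_cons span_seq1 => /andP[uNv].
rewrite seq1_free => v0.
have [v2|v2] := eqVneq (c 2 v) 0.
  by exists 0, 1; rewrite scale0r scale1r add0r; apply: pos.
(* The third coordinates of [u] and [v] cancel in this combination. *)
exists (c 2 v), (- c 2 u); apply: pos.
  apply: contra uNv; rewrite scaleNr subr_eq0 => /eqP /esym e.
  by apply/vlineP; exists ((c 2 v)^-1 * c 2 u); rewrite -scalerA e scalerK.
by rewrite /c linearD !linearZ /=; ring.
Qed.

Lemma binary_form_diag_gt0 {R : realDomainType} (A B C s t : R) :
  0 < A * s ^+ 2 + 2 * B * s * t + C * t ^+ 2 -> 0 <= A * C - B ^+ 2 ->
  0 < A \/ 0 < C.
Proof.
move=> pos d_ge0; apply/orP; rewrite !ltNge -negb_and.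
apply: contraTN pos => /andP[]; rewrite -leNgt le_eqVlt => /predU1P[A0|A0] C0.
  have /eqP : B ^+ 2 = 0 by apply/le_anti; rewrite sqr_ge0 andbT; rewrite A0 mul0r in d_ge0; lra.
  rewrite sqrf_eq0 => /eqP ->; rewrite A0 mul0r mulr0 !mul0r !add0r.
  by rewrite mulr_le0_ge0 ?sqr_ge0.
rewrite -(nmulr_rge0 _ A0).
(* Completing the square: for [A < 0] the form would be nonpositive. *)
suff -> : A * (A * s ^+ 2 + 2 * B * s * t + C * t ^+ 2)
    = (A * s + B * t) ^+ 2 + (A * C - B ^+ 2) * t ^+ 2.
  by rewrite addr_ge0 ?sqr_ge0 // mulr_ge0 ?sqr_ge0.
by ring.
Qed.

(** * Passage to the eigenbasis of [ad z] and back *)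

Theorem theorem3p14 (R : realType) (c : R) (c_lt1 : c < 1)
    (g : lieAlgType R) (x y z : g)
    (xyz_basis : basis_of fullv [:: x; y; z])
    (bracket_xy : lie_bracket x y = 0)
    (bracket_zx : lie_bracket z x = y)
    (bracket_zy : lie_bracket z y = - c *: x + 2 *: y)
    (h : {symmetric g}) (h_lorentzian : lorentzian h) :
  let w := Num.sqrt (1 - c) in
  let P := transition_mx w in
  let e := [tuple x; y; z] in
  exists h' : {symmetric g},
    [/\ lorentzian h',
        equivalent_upto_aut e h h' &
        exists2 M : 'M[R]_3, normal_form M & form_mx e h' = P^T *m M *m P].
Proof.
move=> w P e.
have w0 : w != 0 by rewrite gt_eqF // sqrtr_gt0 subr_gt0.
have ew : w ^+ 2 = 1 - c by rewrite sqr_sqrtr // subr_ge0 ltW.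
have ec : c = 1 - w ^+ 2 by rewrite ew; ring.
have e_basis : basis_of fullv e by [].
pose x1 := (w - 1) *: x + y; pose x2 := (- (1 + w)) *: x + y.
have ex : x = (1 / (2 * w)) *: x1 + (- 1 / (2 * w)) *: x2.
  transitivity (1 *: x + 0 *: y); first by rewrite scale1r scale0r addr0.
  rewrite !scalerDr !scalerA addrACA -!scalerDl.
  by congr (_ *: _ + _ *: _); field.
have ey : y = ((1 + w) / (2 * w)) *: x1 + ((w - 1) / (2 * w)) *: x2.
  transitivity (0 *: x + 1 *: y); first by rewrite scale1r scale0r add0r.
  rewrite !scalerDr !scalerA addrACA -!scalerDl.
  by congr (_ *: _ + _ *: _); field.
have f_basis : basis_of fullv [:: x1; x2; z].
  rewrite basisEdim (size_basis e_basis) andbT -(span_basis xyz_basis).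
  have x1_in : x1 \in <<[:: x1; x2; z]>>%VS by rewrite memv_span ?mem_head.
  have x2_in : x2 \in <<[:: x1; x2; z]>>%VS by rewrite memv_span ?inE ?eqxx ?orbT.
  have z_in : z \in <<[:: x1; x2; z]>>%VS by rewrite memv_span ?inE ?eqxx ?orbT.
  apply/span_subvP => u; rewrite !inE => /or3P[] /eqP -> //.
    by rewrite ex memvD ?memvZ.
  by rewrite ey memvD ?memvZ.
have bracket_x1x2 : lie_bracket x1 x2 = 0.
  rewrite !linearDl !linearDr !linearZl_LR !linearZr_LR /= !lie_bracket_alt.
  by rewrite (lie_bracket_antisym y x) bracket_xy oppr0 !scaler0 !addr0.
(* The eigenvalues [1 + w] and [1 - w] have product [c], as [w ^+ 2 = 1 - c]. *)
have bracket_zx1 : lie_bracket z x1 = (1 + w) *: x1.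
  rewrite linearDr linearZr_LR /= bracket_zx bracket_zy scalerDr scalerA addrCA.
  by rewrite -scalerDl ec; congr (_ *: _ + _ *: _); ring.
have bracket_zx2 : lie_bracket z x2 = (1 - w) *: x2.
  rewrite linearDr linearZr_LR /= bracket_zx bracket_zy scalerDr scalerA addrCA.
  by rewrite -scalerDl ec; congr (_ *: _ + _ *: _); ring.
clearbody x1 x2.
pose f := [tuple x1; x2; z].
have fT_basis : basis_of fullv f by [].
have hC u v : h u v = h v u by rewrite hermitian_subproof mul1r.
have det_lt0 : (h x1 x1 * h x2 x2 - h x1 x2 ^+ 2) * h z z <
    h x1 x1 * h x2 z ^+ 2 - 2 * h x1 x2 * h x1 z * h x2 z + h x2 x2 * h x1 z ^+ 2.
  have := lorentzian_det_lt0 h f h_lorentzian fT_basis.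
  rewrite det_mx33 !mxE /= (hC x2 x1) (hC z x1) (hC z x2); lra.
have [s [t pos]] : exists s t, 0 < h (s *: x1 + t *: x2) (s *: x1 + t *: x2).
  apply: lorentzian_plane h_lorentzian _.
  exact: (@catl_free _ _ [:: z] [:: x1; x2]) (basis_free f_basis).
have diag_gt0 : 0 <= h x1 x1 * h x2 x2 - h x1 x2 ^+ 2 -> 0 < h x1 x1 \/ 0 < h x2 x2.
  apply: (binary_form_diag_gt0 _ _ _ s t).
  congr (0 < _): pos.
  rewrite linearDl !linearDr !linearZl_LR !linearZr_LR /= (hC x2 x1).
  by ring.
have [a [b [p [q [a0 b0 nf]]]]] := gram_normal_form _ _ _ _ _ _ det_lt0 diag_gt0.
have [phi phi_aut [phi1 phi2 phiz]] :=
  scale_shear_automorphism f_basis bracket_x1x2 bracket_zx1 bracket_zx2 a b p q a0 b0.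
exists (pullback h phi : {symmetric g}); split.
- by apply: lorentzian_pullback => //; case: phi_aut.
- by exists phi => //; apply: form_mx_pullback.
(* The matrix [M] is the Gram matrix of the new metric in the eigenbasis, that is, of [h] on the
   images of [x1], [x2], [z] under [phi]. *)
exists (form_mx f (pullback h phi : {symmetric g})).
  congr (normal_form _): nf; apply/matrixP => i j; rewrite !mxE /= /pullback.
  case: i j => [[|[|[|//]]] ?] [[|[|[|//]]] ?] /=;
    rewrite ?phi1 ?phi2 ?phiz ?linearDl ?linearDr ?linearZl_LR ?linearZr_LR /=;
    rewrite ?(hC x2 x1) ?(hC z x1) ?(hC z x2); ring.
(* The columns of [P] are the coordinates in [ex] and [ey], completed by those of [z]. *)
have coord_P : \matrix_(i < 3, j < 3) coord f i e`_j = P.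
  apply/matrixP => i j; rewrite mxE.
  rewrite -[RHS](coord_sum_free (fun k => P k j) i (basis_free fT_basis)).
  congr (coord f i _); rewrite !big_ord_recl big_ord0 !mxE addr0 /=.
  case: j => [[|[|[|//]]] ?] /=; rewrite ?scale0r ?scale1r ?add0r ?addr0 //.
by rewrite -coord_P; apply: form_mx_family.
Qed.
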